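(* For all simplicial sets $X$, $Y$, $Z$ the following identities of maps hold: $$AW_{X,Y\times Z}\,H_{X\times Y,Z}=(1\otimes H_{Y,Z})\,AW_{X,Y\times Z}\colon C(X\times Y\times Z)\to C(X)\otimes C(Y\times Z),$$ $$AW_{X\times Y,Z}\,H_{X,Y\times Z}=(H_{X,Y}\otimes1)\,AW_{X\times Y,Z}\colon C(X\times Y\times Z)\to C(X\times Y)\otimes C(Z).$$
   Context: $\Bbbk$ is a commutative ring with unit; $C(X)$ is the normalized chain complex of a simplicial set $X$ over $\Bbbk$. The Koszul sign rule is used, e.g. $(1\otimes h)(x\otimes c)=(-1)^{|h||x|}x\otimes h(c)$. For a simplex $x$ write $\partial_p^qx=\partial_p\partial_{p+1}\cdots\partial_qx$ for $p\le q$ and $\partial_p^{p-1}x=x$. For a set $\alpha=\{\alpha_1<\dots<\alpha_p\}$ of non-negative integers write $s_\alpha x=s_{\alpha_p}\cdots s_{\alpha_1}x$, $s_\emptyset x=x$, and $\alpha+m=\{\alpha_1+m,\dots,\alpha_p+m\}$. A $(p,q)$-shuffle $(\alpha,\beta)\vdash(p,q)$ is a partition of $\{0,\dots,p+q-1\}$ into sets $\alpha,\beta$ of sizes $p,q$; $(-1)^{(\alpha,\beta)}$ is the sign of the permutation $(\alpha_1<\dots<\alpha_p,\beta_1<\dots<\beta_q)$. The Alexander--Whitney map is $AW_{X,Y}\colon C(X\times Y)\to C(X)\otimes C(Y)$, $AW(x,y)=\sum_{k=0}^n\partial_{k+1}^nx\otimes\partial_0^{k-1}y$ for $(x,y)\in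 X_n\times Y_n$. The Eilenberg--Mac Lane homotopy $H_{X,Y}\colon C(X\times Y)\to C(X\times Y)$ (degree $+1$) is, for $(x,y)\in X_n\times Y_n$ and with $m=n-p-q$, $$H(x,y)=\sum_{p,q\ge0,\;p+q<n}\ \sum_{(\alpha,\beta)\vdash(p+1,q)}(-1)^{m+1+(\alpha,\beta)}\bigl(s_{\beta+m}\,s_{m-1}\,\partial_{n-q+1}^nx,\ s_{\alpha+m}\,\partial_m^{n-q-1}y\bigr).$$ $H_{X\times Y,Z}$ and $H_{X,Y\times Z}$ (and similarly the $AW$ maps) arise from regarding $X\times Y\times Z$ as $(X\times Y)\times Z$ and $X\times(Y\times Z)$, respectively. *)

(* Defs.v *)
From HB Require Import structures.
From mathcomp Require Import all_boot all_order perm all_algebra.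
From mathcomp Require Import finmap boolp.
From mathcomp.multinomials Require Import monalg.
From mathcomp Require Import zify.

Set Implicit Arguments.
Unset Strict Implicit.
Unset Printing Implicit Defensive.

Import GRing.Theory.

Local Open Scope ring_scope.
Local Open Scope quotient_scope.

(* Modules are taken over an arbitrary [comPzRingType], i.e. the zero ring is
   allowed.  The [lmodType] instance of [{malg k[S]}] in the library asks for
   1 != 0, hence the copy of that instance on [freemod] below. *)

Section FreeModule.
Variables (k : pzRingType) (S : Type).

Definition freemod : Type := {malg k[{classic S}]}.
HB.instance Definition _ := GRing.Zmodule.on freemod.

Definition gen (s : S) : freemod := mkmalgU (s : {classic S}) 1.

Definition fm_scale (c : k) (g : freemod) : freemod :=
  \sum_(s <- msupp g) mkmalgU s (c * mcoeff s g).

Lemma fm_scaleE c (g : freemod) s : mcoeff s (fm_scale c g) = c * mcoeff s g.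
Proof.
rewrite /fm_scale [in RHS](monalgE g) !(raddf_sum (mcoeff s)) mulr_sumr.
by apply: eq_bigr => i _; rewrite /= !mcoeffU mulrnAr.
Qed.

Lemma fm_scaleA c1 c2 g : fm_scale c1 (fm_scale c2 g) = fm_scale (c1 * c2) g.
Proof. by apply/malgP => s; rewrite !fm_scaleE mulrA. Qed.

Lemma fm_scale1 : left_id 1 fm_scale.
Proof. by move=> g; apply/malgP => s; rewrite fm_scaleE mul1r. Qed.

Lemma fm_scaleDr : right_distributive fm_scale +%R.
Proof.
by move=> c g h; apply/malgP => s; rewrite mcoeffD !fm_scaleE mcoeffD mulrDr.
Qed.

Lemma fm_scaleDl g : {morph fm_scale^~ g : c d / c + d}.
Proof.
by move=> c d; apply/malgP => s; rewrite mcoeffD !fm_scaleE mulrDl.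
Qed.

HB.instance Definition _ := GRing.Zmodule_isLmodule.Build k freemod
  fm_scaleA fm_scale1 fm_scaleDr fm_scaleDl.

Lemma mcoeff_scale c (g : freemod) s : mcoeff s (c *: g) = c * mcoeff s g.
Proof. exact: fm_scaleE. Qed.

Lemma freemodE (g : freemod) :
  g = \sum_(s <- msupp g) mcoeff s g *: gen s.
Proof.
rewrite [LHS]monalgE; apply: eq_bigr => s _.
by apply/malgP => t; rewrite mcoeff_scale !mcoeffU mulr_natr.
Qed.

Section Lift.
Variables (V : lmodType k) (F : S -> V).

Definition free_lift (g : freemod) : V :=
  \sum_(s <- msupp g) mcoeff s g *: F s.

Lemma free_liftEw (g : freemod) (D : {fset {classic S}}) :
  (msupp g `<=` D)%fset -> free_lift g = \sum_(s <- D) mcoeff s g *: F s.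
Proof.
move=> sgD; rewrite /free_lift (big_fset_incl _ sgD) // => s _ sNg.
by rewrite mcoeff_outdom // scale0r.
Qed.

Lemma free_lift_is_linear : linear free_lift.
Proof.
move=> c g h; pose D := (msupp g `|` msupp h `|` msupp (c *: g + h))%fset.
rewrite !(@free_liftEw _ D) ?fsubsetUr //; last first.
- by rewrite /D -fsetUA fsubsetUl.
- by rewrite /D fsetUAC fsubsetUr.
rewrite scaler_sumr -big_split /=; apply: eq_bigr => s _.
by rewrite mcoeffD mcoeff_scale scalerDl scalerA.
Qed.

HB.instance Definition _ :=
  GRing.isLinear.Build k freemod V *:%R free_lift free_lift_is_linear.

Lemma free_lift_gen s : free_lift (gen s) = F s.
Proof.
rewrite (@free_liftEw _ [fset (s : {classic S})]%fset); last exact: msuppU_le.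
by rewrite big_seq_fset1 mcoeffUU scale1r.
Qed.
End Lift.

Lemma freemod_ext (V : lmodType k) (f g : {linear freemod -> V}) :
  (forall s, f (gen s) = g (gen s)) -> f =1 g.
Proof.
move=> fg x; rewrite (freemodE x) !linear_sum; apply: eq_bigr => s _.
by rewrite !linearZ /= fg.
Qed.

End FreeModule.

Section SpanQuotient.
Variables (k : pzRingType) (V : lmodType k) (S : V -> Prop).

Definition span : {pred V} :=
  fun v => `[< forall W : submodClosed V, (forall u, S u -> u \in W) -> v \in W >].

Lemma spanP v :
  reflect (forall W : submodClosed V, (forall u, S u -> u \in W) -> v \in W)
          (v \in span).
Proof. exact: asboolP. Qed.

Lemma mem_span v : S v -> v \in span.
Proof. by move=> Sv; apply/spanP => W; apply. Qed.

Fact span_submod_closed : submod_closed span.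
Proof.
split=> [|c u v /spanP Hu /spanP Hv]; apply/spanP => W SW; first exact: rpred0.
by rewrite rpredD ?rpredZ ?Hu ?Hv.
Qed.
HB.instance Definition _ := GRing.isSubmodClosed.Build k V span span_submod_closed.

Definition quotmod : Type := {ideal_quot span}.
HB.instance Definition _ := GRing.Zmodule.on quotmod.

Definition quot_pi (v : V) : quotmod := \pi_({ideal_quot span}) v.

Lemma quot_pi_eq u v : (quot_pi u == quot_pi v) = (u - v \in span).
Proof. by rewrite Quotient.idealrBE. Qed.

Lemma quot_piB : {morph quot_pi : u v / u - v}.
Proof. exact: raddfB. Qed.

Lemma quot_piD : {morph quot_pi : u v / u + v}.
Proof. exact: raddfD. Qed.

Lemma quot_reprK (x : quotmod) :
  quot_pi (repr (x : {ideal_quot span})) = x.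
Proof. exact: reprK. Qed.

Definition quot_scale (c : k) (x : quotmod) : quotmod :=
  quot_pi (c *: repr (x : {ideal_quot span})).

Lemma quot_pi_scale c v : quot_pi (c *: v) = quot_scale c (quot_pi v).
Proof.
apply/eqP; rewrite quot_pi_eq -scalerBr rpredZ // -quot_pi_eq.
by rewrite quot_reprK.
Qed.

Fact quot_scaleA c1 c2 x :
  quot_scale c1 (quot_scale c2 x) = quot_scale (c1 * c2) x.
Proof. by rewrite -[x]quot_reprK -!quot_pi_scale scalerA. Qed.

Fact quot_scale1 : left_id 1 quot_scale.
Proof. by move=> x; rewrite -[x]quot_reprK -quot_pi_scale scale1r. Qed.

Fact quot_scaleDr : right_distributive quot_scale +%R.
Proof.
move=> c x y; rewrite -[x]quot_reprK -[y]quot_reprK.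
by rewrite -quot_piD -!quot_pi_scale scalerDr quot_piD.
Qed.

Fact quot_scaleDl x : {morph quot_scale^~ x : c d / c + d}.
Proof.
by move=> c d; rewrite -[x]quot_reprK -!quot_pi_scale scalerDl quot_piD.
Qed.

HB.instance Definition _ := GRing.Zmodule_isLmodule.Build k quotmod
  quot_scaleA quot_scale1 quot_scaleDr quot_scaleDl.

Fact quot_pi_is_linear : linear quot_pi.
Proof. by move=> c u v; rewrite quot_piD quot_pi_scale. Qed.
HB.instance Definition _ :=
  GRing.isLinear.Build k V quotmod *:%R quot_pi quot_pi_is_linear.

Section Lift.
Variables (W : lmodType k) (f : {linear V -> W}).
Hypothesis f0 : forall v, S v -> f v = 0.

(* The unused argument records that f factors through the quotient. *)
Definition quot_lift of (forall v, S v -> f v = 0) := fun x : quotmod =>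
  f (repr (x : {ideal_quot span})).

Fact ker_submod_closed : submod_closed [pred v | f v == 0].
Proof.
split=> [|c u v]; rewrite !inE ?linear0 // => /eqP fu /eqP fv.
by rewrite linearP fu fv scaler0 addr0.
Qed.
HB.instance Definition _ :=
  GRing.isSubmodClosed.Build k V [pred v | f v == 0] ker_submod_closed.

Lemma quot_lift_pi v : quot_lift f0 (quot_pi v) = f v.
Proof.
apply/eqP; rewrite -subr_eq0 -linearB /=.
have : repr (quot_pi v : {ideal_quot span}) - v \in span.
  by rewrite -quot_pi_eq quot_reprK.
move/spanP => /(_ [pred v | f v == 0]); apply=> u Su.
by rewrite inE f0.
Qed.

Fact quot_lift_is_linear : linear (quot_lift f0).
Proof.
move=> c x y; rewrite -[x]quot_reprK -[y]quot_reprK.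
by rewrite -quot_pi_is_linear !quot_lift_pi linearP.
Qed.
HB.instance Definition _ :=
  GRing.isLinear.Build k quotmod W *:%R (quot_lift f0) quot_lift_is_linear.
End Lift.

End SpanQuotient.

Section Tensor.
Variable k : comPzRingType.

Section Def.
Variables M N : lmodType k.

Definition pair_gen (x : M) (y : N) : freemod k (M * N) := gen k (x, y).

Variant tensor_rel : freemod k (M * N) -> Prop :=
| TensorDl x x' y : tensor_rel (pair_gen (x + x') y - (pair_gen x y + pair_gen x' y))
| TensorDr x y y' : tensor_rel (pair_gen x (y + y') - (pair_gen x y + pair_gen x y'))
| TensorZl c x y : tensor_rel (pair_gen (c *: x) y - c *: pair_gen x y)
| TensorZr c x y : tensor_rel (pair_gen x (c *: y) - c *: pair_gen x y).

Definition tensor : lmodType k := quotmod tensor_rel.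

Definition tens (x : M) (y : N) : tensor := quot_pi tensor_rel (pair_gen x y).

Lemma tensDl x x' y : tens (x + x') y = tens x y + tens x' y.
Proof.
by apply/eqP; rewrite /tens -linearD quot_pi_eq mem_span //; exact: TensorDl.
Qed.

Lemma tensDr x y y' : tens x (y + y') = tens x y + tens x y'.
Proof.
by apply/eqP; rewrite /tens -linearD quot_pi_eq mem_span //; exact: TensorDr.
Qed.

Lemma tensZl c x y : tens (c *: x) y = c *: tens x y.
Proof.
by apply/eqP; rewrite /tens -linearZ quot_pi_eq mem_span //; exact: TensorZl.
Qed.

Lemma tensZr c x y : tens x (c *: y) = c *: tens x y.
Proof.
by apply/eqP; rewrite /tens -linearZ quot_pi_eq mem_span //; exact: TensorZr.
Qed.

Lemma tens0l y : tens 0 y = 0.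
Proof. by rewrite -(scale0r 0) tensZl scale0r. Qed.

Lemma tens0r x : tens x 0 = 0.
Proof. by rewrite -(scale0r 0) tensZr scale0r. Qed.
End Def.

Section Map.
Variables (M N M' N' : lmodType k).
Variables (f : {linear M -> M'}) (g : {linear N -> N'}).

Definition tensor_map_gen : {linear freemod k (M * N) -> tensor M' N'} :=
  free_lift (fun xy => tens (f xy.1) (g xy.2)).

Fact tensor_map_rel v : tensor_rel v -> tensor_map_gen v = 0.
Proof.
by case=> [x x' y|x y y'|c x y|c x y]; apply/eqP;
  rewrite linearB subr_eq0 ?linearD ?linearZ /= !free_lift_gen /=
    ?linearD ?linearZ /= ?(tensDl, tensDr, tensZl, tensZr).
Qed.

Definition tensor_map : {linear tensor M N -> tensor M' N'} :=
  quot_lift tensor_map_rel.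

Lemma tensor_mapE x y : tensor_map (tens x y) = tens (f x) (g y).
Proof. exact: etrans (quot_lift_pi _ _) (free_lift_gen _ _). Qed.
End Map.

End Tensor.

(* [delta m n] is the set of morphisms [m] -> [n] of the simplex category. *)

Definition monotone m n (f : {ffun 'I_m.+1 -> 'I_n.+1}) : bool :=
  [forall i : 'I_m.+1, forall j : 'I_m.+1, (i <= j)%N ==> (f i <= f j)%N].

Record delta m n := Delta {
  delta_fun :> {ffun 'I_m.+1 -> 'I_n.+1};
  deltaP : monotone delta_fun }.
HB.instance Definition _ m n := [isSub for @delta_fun m n].

Lemma delta_mono m n (f : delta m n) (i j : 'I_m.+1) :
  (i <= j)%N -> (f i <= f j)%N.
Proof. by have /forallP/(_ i)/forallP/(_ j)/implyP := deltaP f. Qed.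

Lemma delta_ext m n (f g : delta m n) :
  (forall i, f i = g i :> nat) -> f = g.
Proof. by move=> fg; apply/val_inj/ffunP => i; apply/val_inj/fg. Qed.

Fact mk_delta_subproof m n (f : 'I_m.+1 -> 'I_n.+1) :
  (forall i j : 'I_m.+1, i <= j -> f i <= f j)%N -> monotone (finfun f).
Proof.
by move=> fP; apply/forallP => i; apply/forallP => j; apply/implyP;
  rewrite !ffunE; apply: fP.
Qed.

Definition mk_delta m n (f : 'I_m.+1 -> 'I_n.+1) fP : delta m n :=
  Delta (@mk_delta_subproof m n f fP).

Definition delta_id n : delta n n := @mk_delta n n id (fun i j ij => ij).

Definition delta_comp m n p (g : delta n p) (f : delta m n) : delta m p :=
  mk_delta (fun i j ij => delta_mono g (delta_mono f ij)).

Fact coface_subproof n (i : 'I_n.+2) (j j' : 'I_n.+1) :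
  (j <= j' -> lift i j <= lift i j')%N.
Proof. by rewrite /= leq_bump2. Qed.

(* [n] -> [n+1] missing the value i *)
Definition coface n (i : 'I_n.+2) : delta n n.+1 :=
  mk_delta (@coface_subproof n i).

Fact unbump_ord n (i : 'I_n.+1) (j : 'I_n.+2) : (unbump i j < n.+1)%N.
Proof. by rewrite /unbump; case: i j => i Hi [j Hj] /=; lia. Qed.

Fact codegen_subproof n (i : 'I_n.+1) (j j' : 'I_n.+2) :
  (j <= j' -> Ordinal (unbump_ord i j) <= Ordinal (unbump_ord i j'))%N.
Proof. by rewrite /= /unbump; lia. Qed.

(* [n+1] -> [n] taking the value i twice *)
Definition codegen n (i : 'I_n.+1) : delta n.+1 n :=
  mk_delta (@codegen_subproof n i).

Record sset := SSet {
  simplex :> nat -> Type;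
  act : forall m n, delta m n -> simplex n -> simplex m;
  act_id : forall n (x : simplex n), act (delta_id n) x = x;
  act_comp : forall m n p (f : delta m n) (g : delta n p) (x : simplex p),
    act f (act g x) = act (delta_comp g f) x }.
Arguments act {s m n}.

Record smap (X Y : sset) := SMap {
  smap_fun :> forall n, X n -> Y n;
  smap_act : forall m n (f : delta m n) (x : X n),
    smap_fun (act f x) = act f (smap_fun x) }.

Definition prod_act (X Y : sset) m n (f : delta m n) (xy : X n * Y n) :
  X m * Y m := (act f xy.1, act f xy.2).

Fact prod_act_id (X Y : sset) n (xy : X n * Y n) :
  prod_act (delta_id n) xy = xy.
Proof. by case: xy => x y; rewrite /prod_act !act_id. Qed.

Fact prod_act_comp (X Y : sset) m n p (f : delta m n) (g : delta n p)
    (xy : X p * Y p) :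
  prod_act f (prod_act g xy) = prod_act (delta_comp g f) xy.
Proof. by rewrite /prod_act !act_comp. Qed.

Definition sprod (X Y : sset) : sset := SSet (@prod_act_id X Y) (@prod_act_comp X Y).

Definition sprod_assoc (X Y Z : sset) :
  smap (sprod (sprod X Y) Z) (sprod X (sprod Y Z)) :=
  @SMap (sprod (sprod X Y) Z) (sprod X (sprod Y Z))
    (fun n xyz => (xyz.1.1, (xyz.1.2, xyz.2))) (fun m n f xyz => erefl).

Definition sprod_assoc_inv (X Y Z : sset) :
  smap (sprod X (sprod Y Z)) (sprod (sprod X Y) Z) :=
  @SMap (sprod X (sprod Y Z)) (sprod (sprod X Y) Z)
    (fun n xyz => ((xyz.1, xyz.2.1), xyz.2.2)) (fun m n f xyz => erefl).

Section Operators.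
Variable X : sset.

Definition face n (i : 'I_n.+2) (x : X n.+1) : X n := act (coface i) x.
Definition degen n (i : 'I_n.+1) (x : X n) : X n.+1 := act (codegen i) x.

Definition castX m n (e : m = n) (x : X m) : X n := ecast n (X n) e x.

(* [faces p l x] = d_p d_{p+1} ... d_{p+l-1} x *)
Fixpoint faces (p l : nat) n : X (l + n) -> X n :=
  match l with
  | 0 => fun x => x
  | l'.+1 => fun x => faces p (@face (l' + n) (inord (p + l')) x)
  end.

(* [degens [:: a_1; ...; a_l] x] = s_{a_1} ... s_{a_l} x *)
Fixpoint degens (a : seq nat) n (x : X n) : X (size a + n) :=
  match a with
  | [::] => x
  | i :: a' => @degen (size a' + n) (inord i) (degens a' x)
  end.

End Operators.

(* [acts_by g x y]: y is obtained from x by the simplicial operator given on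
   vertices by g. *)
Section ActsBy.
Variable X : sset.

Definition acts_by (g : nat -> nat) m n (x : X n) (y : X m) : Prop :=
  exists2 f : delta m n, (forall j, f j = g j :> nat) & y = act f x.

Lemma acts_by_eq g g' m n (x : X n) (y : X m) :
  (forall j, j <= m -> g j = g' j)%N -> acts_by g x y -> acts_by g' x y.
Proof.
by move=> gg' [f fg ->]; exists f => // j; rewrite fg gg' // -ltnS.
Qed.

Lemma acts_by_comp g h l m n (x : X n) (y : X m) (z : X l) :
  acts_by g x y -> acts_by h y z -> acts_by (g \o h) x z.
Proof.
case=> f fg -> [f' fh ->]; rewrite act_comp; exists (delta_comp f f') => // j.
by rewrite /= ffunE fg fh.
Qed.

Lemma acts_by_id n (x : X n) : acts_by id x x.
Proof. by exists (delta_id n); rewrite ?act_id // => j; rewrite ffunE. Qed.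

Lemma acts_by_cast m n (e : m = n) (x : X m) : acts_by id x (castX e x).
Proof. by case: n / e; apply: acts_by_id. Qed.

Lemma acts_by_degen n (i : 'I_n.+1) (x : X n) :
  acts_by (unbump i) x (degen i x).
Proof. by exists (codegen i) => // j; rewrite ffunE. Qed.

Lemma acts_by_face n (i : 'I_n.+2) (x : X n.+1) :
  acts_by (bump i) x (face i x).
Proof. by exists (coface i) => // j; rewrite ffunE. Qed.

Lemma acts_by_faces p l n (x : X (l + n)) : (p <= n.+1)%N ->
  acts_by (fun j => if (j < p)%N then j else j + l)%N x (faces p x).
Proof.
move=> pn; elim: l x => [|l IH] x /=.
  by apply: acts_by_eq (acts_by_id x) => j _; case: ifP => //; rewrite addn0.
apply: acts_by_eq (acts_by_comp (acts_by_face _ _) (IH _)) => j _ /=.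
by rewrite inordK /bump; [case: ifP; lia|lia].
Qed.

Lemma acts_by_degens (a : seq nat) n (x : X n) :
  sorted gtn a -> all (fun i => i < size a + n)%N a ->
  acts_by (fun j => j - count (fun i => i < j)%N a)%N x (degens a x).
Proof.
elim: a => [|i a IH] /= sa.
  by move=> _; apply: acts_by_eq (acts_by_id x) => j _; rewrite subn0.
case/andP=> i_lt _.
have lt_i : all (fun i' => i' < i)%N a.
  by apply: order_path_min sa => u v w /=; lia.
have {}IH : acts_by (fun j => j - count (fun i => i < j)%N a)%N x (degens a x).
  apply: IH; first exact: path_sorted sa.
  by apply: sub_all lt_i => u /=; lia.
apply: acts_by_eq (acts_by_comp IH (acts_by_degen _ _)) => j _ /=.
rewrite inordK // /unbump; case: ltnP => ij /=; last by rewrite subn0 add0n.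
have cnt u : (i <= u)%N -> count (fun i => i < u)%N a = size a.
  move=> iu; apply/eqP; rewrite -all_count.
  by apply: sub_all lt_i => v /= vi; apply: leq_trans iu.
by rewrite !cnt; lia.
Qed.

Lemma acts_by_degenerate g m n (x : X n) (y : X m.+1) (j : 'I_m.+1) :
  acts_by g x y -> g j = g j.+1 -> y = degen j (act (coface (lift ord0 j)) y).
Proof.
case=> f fg -> gj; rewrite /degen !act_comp; congr (act _ x).
apply: delta_ext => i; rewrite /= !ffunE.
have [ij|ij] := eqVneq (i : nat) j.+1.
  transitivity (g j); first by rewrite fg ij gj.
  by rewrite fg; congr g; rewrite /= /bump /unbump; lia.
congr (nat_of_ord (f _)); apply/val_inj; rewrite /=.
by rewrite /bump /unbump; lia.
Qed.
End ActsBy.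

Section Chains.
Variable k : comPzRingType.

(* The underlying module of the normalized chain complex of X, that is the
   direct sum over n of k[X_n] modulo degenerate simplices; the differential is
   not needed for identities between maps.  Tensor products of complexes are
   formed on these total modules, [chain x] having degree n for x in X_n, so
   that C(X) (x) C(Y) contains C_i(X) (x) C_j(Y) in degree i + j. *)
Section Def.
Variable X : sset.

Definition simplices : Type := {n : nat & X n}.

Variant degenerate : freemod k simplices -> Prop :=
| Degenerate n (i : 'I_n.+1) (x : X n) :
    degenerate (gen k (existT X n.+1 (degen i x))).

Definition chains : lmodType k := quotmod degenerate.

Definition chain n (x : X n) : chains :=
  quot_pi degenerate (gen k (existT X n x)).

Lemma chain_degen n (i : 'I_n.+1) (x : X n) : chain (degen i x) = 0.
Proof.
apply/eqP; rewrite -(linear0 (quot_pi degenerate)) quot_pi_eq subr0.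
by rewrite mem_span.
Qed.

Section Lift.
Variables (V : lmodType k) (F : forall n, X n -> V).
Hypothesis F0 : forall n (i : 'I_n.+1) (x : X n), F (degen i x) = 0.

Definition chains_lift_gen : {linear freemod k simplices -> V} :=
  free_lift (fun x : simplices => F (projT2 x)).

Fact chains_lift_rel v : degenerate v -> chains_lift_gen v = 0.
Proof. by case=> n i x; rewrite /= free_lift_gen /= F0. Qed.

Definition chains_lift : {linear chains -> V} := quot_lift chains_lift_rel.

Lemma chains_liftE n (x : X n) : chains_lift (chain x) = F x.
Proof. exact: etrans (quot_lift_pi _ _) (free_lift_gen _ _). Qed.
End Lift.
End Def.

Lemma chain_acts_by0 (X : sset) g m n (x : X n) (y : X m) (j : nat) :
  (j < m)%N -> acts_by g x y -> g j = g j.+1 -> chain y = 0.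
Proof.
case: m y => // m y jm gxy gj.
by rewrite (@acts_by_degenerate X g m n x y (Ordinal jm) gxy gj) chain_degen.
Qed.

Lemma chain_pair_acts_by0 (X Y : sset) g h m n n' (x : X n) (y : Y n')
    (u : X m) (v : Y m) (j : nat) : (j < m)%N ->
  acts_by g x u -> acts_by h y v -> g j = g j.+1 -> h j = h j.+1 ->
  chain ((u, v) : sprod X Y m) = 0.
Proof.
case: m u v => // m u v jm gxu hyv gj hj.
rewrite (@acts_by_degenerate X g m n x u (Ordinal jm) gxu gj).
rewrite (@acts_by_degenerate Y h m n' y v (Ordinal jm) hyv hj).
exact: (@chain_degen (sprod X Y) m (Ordinal jm) (_, _)).
Qed.

Arguments chains_lift {X V} F F0.

Section ChainMap.
Variables (X Y : sset) (f : smap X Y).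

Fact chain_map_degen n (i : 'I_n.+1) (x : X n) : chain (f _ (degen i x)) = 0.
Proof. by rewrite smap_act; apply: chain_degen. Qed.

Definition chain_map : {linear chains X -> chains Y} :=
  chains_lift (fun n x => chain (f n x)) chain_map_degen.
End ChainMap.

Section Koszul.
Variable X : sset.

Fact koszul_sign_degen (d n : nat) (i : 'I_n.+1) (x : X n) :
  (-1) ^+ (d * n.+1) *: chain (degen i x) = 0.
Proof. by rewrite chain_degen scaler0. Qed.

(* multiplication by (-1)^{d|x|} on homogeneous elements x *)
Definition koszul_sign (d : nat) : {linear chains X -> chains X} :=
  chains_lift (fun n x => (-1) ^+ (d * n) *: chain x) (koszul_sign_degen d).
End Koszul.

(* (f (x) g)(x (x) y) = (-1)^{d|x|} f(x) (x) g(y) for g homogeneous of degree d *)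
Definition koszul_tensor (X Y X' Y' : sset) (d : nat)
    (f : {linear chains X -> chains X'}) (g : {linear chains Y -> chains Y'}) :
  {linear tensor (chains X) (chains Y) -> tensor (chains X') (chains Y')} :=
  tensor_map (f \o @koszul_sign X d) g.

Section AlexanderWhitney.
Variables X Y : sset.

(* d_{l+1} ... d_n x *)
Definition AW_front n (x : X n) (l : 'I_n.+1) : X l :=
  @faces X l.+1 (n - l) l (castX (esym (subnK (leq_ord l))) x).

(* d_0 ... d_{l-1} y *)
Definition AW_back n (y : Y n) (l : 'I_n.+1) : Y (n - l)%N :=
  @faces Y 0 l (n - l)%N (castX (esym (subnKC (leq_ord l))) y).

Definition AW_simplex n (xy : sprod X Y n) : tensor (chains X) (chains Y) :=
  \sum_(l < n.+1) tens (chain (AW_front xy.1 l)) (chain (AW_back xy.2 l)).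

Fact AW_degen n (i : 'I_n.+1) (xy : sprod X Y n) : AW_simplex (degen i xy) = 0.
Proof.
apply: big1 => l _; have [il|li] := ltnP i l.
- rewrite (_ : chain (AW_front _ _) = 0) ?tens0l //.
  apply: (chain_acts_by0 il).
    apply: acts_by_comp (acts_by_faces _ (leqnn _)).
    exact: acts_by_comp (acts_by_degen _ _) (acts_by_cast _ _).
  by rewrite /= /unbump !ltnS (ltnW il) il ltnn leqnn subn0 subn1.
- rewrite (_ : chain (AW_back _ _) = 0) ?tens0r //.
  have il : (i - l < n.+1 - l)%N by rewrite ltn_sub2r // (leq_ltn_trans li).
  apply: (chain_acts_by0 il).
    apply: acts_by_comp (acts_by_faces _ (leq0n _)).
    exact: acts_by_comp (acts_by_degen _ _) (acts_by_cast _ _).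
  by rewrite /= /unbump; lia.
Qed.

Definition AW : {linear chains (sprod X Y) -> tensor (chains X) (chains Y)} :=
  chains_lift AW_simplex AW_degen.
End AlexanderWhitney.

End Chains.
Arguments chains_lift {k X V} F F0.

(* A (p,q)-shuffle is recorded by its first part alpha; beta is [~: alpha]. *)
Definition shuffle p q := {a : {set 'I_(p + q)} | #|a| == p}.

Section Shuffle.
Variables (p q : nat) (a : shuffle p q).

Definition sh_alpha : {set 'I_(p + q)} := val a.
Definition sh_beta : {set 'I_(p + q)} := ~: val a.

Lemma card_alpha : #|sh_alpha| = p.
Proof. exact: (eqP (valP a)). Qed.

Lemma card_beta : #|sh_beta| = q.
Proof. by rewrite cardsCs setCK card_ord card_alpha addKn. Qed.

Definition sh_seq : seq 'I_(p + q) := enum sh_alpha ++ enum sh_beta.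

Fact sh_perm_subproof : injective (fun i : 'I_(p + q) => nth i sh_seq i).
Proof.
have sz : size sh_seq = (p + q)%N.
  by rewrite size_cat -!cardE card_alpha card_beta.
have us : uniq sh_seq.
  rewrite cat_uniq !enum_uniq andbT; apply/hasPn => i.
  by rewrite !mem_enum inE.
move=> i j; rewrite (set_nth_default j) ?sz // => /eqP.
by rewrite nth_uniq ?sz // => /eqP /val_inj.
Qed.

(* alpha_1 < ... < alpha_p, beta_1 < ... < beta_q in one-line notation *)
Definition sh_perm : {perm 'I_(p + q)} := perm sh_perm_subproof.
End Shuffle.

Section ShiftedSets.
Variable N : nat.
Implicit Type A : {set 'I_N}.

(* A + m in decreasing order, so that [degens (shift_rev m A)] is
   s_{A + m} *)
Definition shift_rev (m : nat) A : seq nat :=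
  rev [seq (i + m)%N | i : 'I_N <- enum A].

Lemma size_shift_rev m A : size (shift_rev m A) = #|A|.
Proof. by rewrite size_rev size_map cardE. Qed.

Lemma shift_rev_sorted m A : sorted gtn (shift_rev m A).
Proof.
rewrite rev_sorted sorted_map; apply: (@sub_sorted _ (relpre val ltn)).
  by move=> i j /=; rewrite ltn_add2r.
rewrite /enum_mem -enumT; apply: sorted_filter => [i j l /=|].
  exact: ltn_trans.
by rewrite -sorted_map val_enum_ord iota_ltn_sorted.
Qed.

Lemma mem_shift_rev m A i :
  reflect (exists2 t : 'I_N, t \in A & i = (t + m)%N) (i \in shift_rev m A).
Proof.
rewrite mem_rev; apply: (iffP mapP) => -[t tA ->]; exists t => //.
  by rewrite mem_enum in tA.
by rewrite mem_enum.
Qed.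

Lemma count_shift_rev m A j : count (fun i => i < j)%N (shift_rev m A) =
  #|[set i in A | (i + m < j)%N]|.
Proof.
rewrite /shift_rev count_rev count_map -size_filter cardE.
rewrite /enum_mem -filter_predI; congr (size _); apply: eq_filter => i.
by rewrite /= !inE andbC.
Qed.

Lemma count_shift_revC m A j : (m <= j <= m + N)%N ->
  (count (fun i => i < j)%N (shift_rev m A) +
   count (fun i => i < j)%N (shift_rev m (~: A)) = j - m)%N.
Proof.
move=> mjN; rewrite !count_shift_rev.
have -> : [set i in A | (i + m < j)%N] = [set i : 'I_N | (i < j - m)%N] :&: A.
  by apply/setP => i; rewrite !inE andbC; congr andb; lia.
have -> : [set i in ~: A | (i + m < j)%N] = [set i : 'I_N | (i < j - m)%N] :\: A.
  by apply/setP => i; rewrite !inE; congr andb; lia.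
rewrite cardsID; have jN : (j - m <= N)%N by lia.
rewrite -sum1_card (eq_bigl (fun i : 'I_N => (i < j - m)%N)); last first.
  by move=> i; rewrite inE.
by rewrite (big_ord_narrow jN) /= sum1_card card_ord.
Qed.

Lemma shift_rev_jump m A r : (r < #|A|)%N -> exists2 j,
  (m <= j < m + N)%N &
  [/\ count (fun i => i < j)%N (shift_rev m A) = r,
      count (fun i => i < j.+1)%N (shift_rev m A) = r.+1 &
      count (fun i => i < j)%N (shift_rev m (~: A)) =
      count (fun i => i < j.+1)%N (shift_rev m (~: A))].
Proof.
move=> rA; have sA := size_shift_rev m A.
have srt : sorted ltn (rev (shift_rev m A)) by rewrite rev_sorted shift_rev_sorted.
set l := rev (shift_rev m A) in srt.
have rl : (r < size l)%N by rewrite size_rev sA.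
have /mem_shift_rev [t tA jE] : nth 0%N l r \in shift_rev m A.
  by rewrite -mem_rev mem_nth.
set j := nth 0%N l r in jE; exists j.
  by rewrite jE addnC leq_addr ltn_add2l ltn_ord.
have cntE u : (u <= size l)%N ->
    (forall i, (i < size l)%N -> (nth 0%N l i < (if u == r then j else j.+1))%N = (i < u)%N) ->
    count (fun i => i < (if u == r then j else j.+1))%N (shift_rev m A) = u.
  move=> ul H; rewrite -count_rev -/l -[l in LHS](mkseq_nth 0%N) count_map.
  rewrite (@eq_in_count _ _ (fun i => i < u)%N); last first.
    by move=> i; rewrite mem_iota /= => il; rewrite H.
  rewrite -size_filter -(subnKC ul) iotaD filter_cat size_cat !size_filter.
  rewrite (@eq_in_count _ _ predT); last by move=> i; rewrite mem_iota /=; lia.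
  rewrite [X in (_ + X)%N](@eq_in_count _ _ pred0); last first.
    by move=> i; rewrite mem_iota /=; lia.
  by rewrite count_predT count_pred0 size_iota addn0; lia.
have mono i i' : (i < size l)%N -> (i' < size l)%N ->
    (nth 0%N l i < nth 0%N l i')%N = (i < i')%N.
  move=> il i'l; apply/idP/idP => [|ii'].
    apply: contraTT; rewrite -!leqNgt leq_eqVlt => /predU1P[->//|i'i].
    by apply/ltnW/(sorted_ltn_nth ltn_trans 0%N srt).
  exact: (sorted_ltn_nth ltn_trans 0%N srt).
split.
- have := cntE r (ltnW rl); rewrite eqxx; apply=> i il; exact: mono.
- have := cntE r.+1 rl; rewrite gtn_eqF //; apply=> i il.
  by rewrite !ltnS leqNgt mono // -leqNgt.
- rewrite !count_shift_rev; congr #|pred_of_set _|; apply/setP => i.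
  rewrite !inE jE; case iA: (i \in A) => //=.
  have : i != t :> nat by apply: contraFneq iA => /val_inj ->.
  by lia.
Qed.
End ShiftedSets.

Section EilenbergMacLane.
Variables (k : comPzRingType) (X Y : sset).

Section Term.
Variables (n : nat) (p q : 'I_n) (a : shuffle p.+1 q).

Let m := (n - p - q)%N.

Fact EML_fst_size : (size (shift_rev m (sh_beta a)) + (n - q).+1 = n.+1)%N.
Proof. by rewrite size_shift_rev card_beta addnS subnKC // ltnW. Qed.

Fact EML_snd_size : (size (shift_rev m (sh_alpha a)) + (n - p) = n.+1)%N.
Proof. by rewrite size_shift_rev card_alpha addSn subnKC // ltnW. Qed.

(* s_{beta+m} s_{m-1} d_{n-q+1} ... d_n x *)
Definition EML_fst (x : X n) : X n.+1 :=
  castX EML_fst_size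
    (degens (shift_rev m (sh_beta a))
      (@degen X (n - q)%N (inord m.-1)
        (@faces X (n - q).+1%N q (n - q)%N
          (castX (esym (subnKC (ltnW (ltn_ord q)))) x)))).

(* s_{alpha+m} d_m ... d_{n-q-1} y *)
Definition EML_snd (y : Y n) : Y n.+1 :=
  castX EML_snd_size
    (degens (shift_rev m (sh_alpha a))
      (@faces Y m p (n - p)%N
        (castX (esym (subnKC (ltnW (ltn_ord p)))) y))).

Hypothesis pq : (p + q < n)%N.

Lemma EML_fst_acts x : acts_by
  (unbump m.-1 \o
   (fun j => j - count (fun i => i < j)%N (shift_rev m (sh_beta a)))%N)
  x (EML_fst x).
Proof.
have Hm : m = (n - p - q)%N by [].
have mq : (m <= n - q)%N by rewrite Hm -subnDA addnC subnDA leq_subr.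
have F := acts_by_comp (acts_by_cast (esym (subnKC (ltnW (ltn_ord q)))) x)
            (acts_by_faces _ (leqnn (n - q).+1%N)).
have G := acts_by_comp F (acts_by_degen (inord m.-1) _).
have H : all (fun i => i < size (shift_rev m (sh_beta a)) + (n - q).+1)%N
             (shift_rev m (sh_beta a)).
  rewrite EML_fst_size; apply/allP => i /mem_shift_rev [t _ ->].
  by case: t => /= t; lia.
have K := acts_by_comp G (acts_by_degens _ (shift_rev_sorted _ _) H).
apply: acts_by_eq (acts_by_comp K (acts_by_cast EML_fst_size _)) => j jn /=.
have -> : (inord m.-1 : 'I_(n - q).+1) = m.-1 :> nat by rewrite inordK; lia.
set u := (j - _)%N; case: ifP => // /negbT.
suff : (unbump m.-1 u <= n - q)%N by lia.
have un : (u <= (n - q).+1)%N.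
  have [jm|mj] := leqP j m; first by rewrite /u; lia.
  have := @count_shift_revC _ m (sh_alpha a) j.
  rewrite -/(sh_beta a) => /(_ _) E.
  have {}E := E ltac:(lia).
  have : (count (fun i => i < j)%N (shift_rev m (sh_alpha a)) <= p.+1)%N.
    by rewrite (leq_trans (count_size _ _)) // size_shift_rev card_alpha.
  by rewrite /u; lia.
by rewrite /unbump; lia.
Qed.

Lemma EML_snd_acts y : acts_by
  ((fun j => if j < m then j else j + p)%N \o
   (fun j => j - count (fun i => i < j)%N (shift_rev m (sh_alpha a)))%N)
  y (EML_snd y).
Proof.
have Hm : m = (n - p - q)%N by [].
have mp : (m <= (n - p).+1)%N by lia.
have F := acts_by_comp (acts_by_cast (esym (subnKC (ltnW (ltn_ord p)))) y)
            (acts_by_faces _ mp).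
have H : all (fun i => i < size (shift_rev m (sh_alpha a)) + (n - p))%N
             (shift_rev m (sh_alpha a)).
  rewrite EML_snd_size; apply/allP => i /mem_shift_rev [t _ ->].
  by case: t => /= t; lia.
have K := acts_by_comp F (acts_by_degens _ (shift_rev_sorted _ _) H).
exact: acts_by_eq (acts_by_comp K (acts_by_cast EML_snd_size _)).
Qed.
End Term.

(* The exponent [sh_perm a] is the parity of the permutation. *)
Definition EML_simplex n (xy : sprod X Y n) : chains k (sprod X Y) :=
  \sum_(p < n) \sum_(q < n | (p + q < n)%N) \sum_(a : shuffle p.+1 q)
    (-1) ^+ (n - p - q + 1 + sh_perm a) *:
    chain k ((EML_fst a xy.1, EML_snd a xy.2) : sprod X Y n.+1).

Fact EML_degen n (i : 'I_n.+1) (xy : sprod X Y n) : EML_simplex (degen i xy) = 0.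
Proof.
apply: big1 => p _; apply: big1 => q pq; apply: big1 => a _.
rewrite (_ : chain _ _ = 0) ?scaler0 //.
have Fx := acts_by_comp (acts_by_degen i xy.1) (EML_fst_acts a pq (degen i xy.1)).
have Fy := acts_by_comp (acts_by_degen i xy.2) (EML_snd_acts a pq (degen i xy.2)).
have jA r := @shift_rev_jump (p.+1 + q) (n.+1 - p - q) (sh_alpha a) r.
have jB r := @shift_rev_jump (p.+1 + q) (n.+1 - p - q) (sh_beta a) r.
rewrite card_alpha -/(sh_beta a) in jA.
rewrite card_beta {3 4}/sh_beta setCK -/(sh_alpha a) in jB.
have cAB j := @count_shift_revC (p.+1 + q) (n.+1 - p - q) (sh_alpha a) j.
rewrite -/(sh_beta a) in cAB.
have cnt0 A (j : nat) : (j <= n.+1 - p - q)%N ->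
    count (fun i => i < j)%N (@shift_rev (p.+1 + q) (n.+1 - p - q) A) = 0%N.
  move=> jm; apply/eqP; rewrite -leqn0 leqNgt -has_count.
  by apply/hasPn => _ /mem_shift_rev [t _ ->]; lia.
have cA0 := cnt0 (sh_alpha a); have cB0 := cnt0 (sh_beta a); clear cnt0.
pose cA j := count (fun i => i < j)%N (shift_rev (n.+1 - p - q) (sh_alpha a)).
pose cB j := count (fun i => i < j)%N (shift_rev (n.+1 - p - q) (sh_beta a)).
pose gx j := unbump i (unbump (n.+1 - p - q).-1 (j - cB j)%N).
pose u j := (j - cA j)%N.
pose gy j := unbump i (if u j < n.+1 - p - q then u j else u j + p)%N.
suff [j jn [gxj gyj]] : exists2 j, (j < n.+2)%N & gx j = gx j.+1 /\ gy j = gy j.+1.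
  exact: (@chain_pair_acts_by0 k X Y gx gy _ _ _ _ _ _ _ j jn Fx Fy gxj gyj).
clear Fx Fy; rewrite {}/gx {}/gy {}/u.
have {}cA0 j : (j <= n.+1 - p - q)%N -> cA j = 0%N by apply: cA0.
have {}cB0 j : (j <= n.+1 - p - q)%N -> cB j = 0%N by apply: cB0.
have {}cAB j : (n.+1 - p - q <= j <= n.+1 - p - q + (p.+1 + q))%N ->
  (cA j + cB j = j - (n.+1 - p - q))%N by apply: cAB.
have {}jA r : (r < p.+1)%N -> exists2 j,
    (n.+1 - p - q <= j < n.+1 - p - q + (p.+1 + q))%N &
    [/\ cA j = r, cA j.+1 = r.+1 & cB j = cB j.+1] by apply: jA.
have {}jB r : (r < q)%N -> exists2 j,
    (n.+1 - p - q <= j < n.+1 - p - q + (p.+1 + q))%N &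
    [/\ cB j = r, cB j.+1 = r.+1 & cA j = cA j.+1] by apply: jB.
clearbody cA cB; clear a xy.
case: i p q pq cA0 cB0 cAB jA jB => i /= ini [p /= pn] [q /= qn] /= pq.
set m := (n.+1 - p - q)%N; have mE : (m + p + q = n.+1)%N by lia.
move: m mE => m mE cA0 cB0 cAB jA jB.
have [im|mi] := ltnP i.+1 m.
  exists i; first by lia.
  rewrite !cA0 ?cB0 ?subn0 ?im ?(ltnW im) //; try lia.
  by rewrite /unbump; lia.
have [iq|qi] := ltnP i (m + p).
  have [|j jm [c1 c2 c3]] := jA (i - m.-1)%N; first by lia.
  have c4 : (j - cB j = i.+1)%N by have := cAB j; lia.
  have c5 : (j.+1 - cB j = i.+2)%N by have := cAB j; lia.
  exists j; first by lia.
  by rewrite -c3 c4 c5 c1 c2 subSS /unbump; split=> //; lia.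
have [|j jm [c1 c2 c3]] := jB (i - (m + p))%N; first by lia.
have c4 : (j - cA j = i - p)%N by have := cAB j; lia.
have c5 : (j.+1 - cA j = (i - p).+1)%N by have := cAB j; lia.
exists j; first by lia.
rewrite -c3 c4 c5 c1 c2 subSS; split=> //.
rewrite !ifF; [|lia|lia].
by rewrite /unbump; lia.
Qed.

Definition EML : {linear chains k (sprod X Y) -> chains k (sprod X Y)} :=
  chains_lift EML_simplex EML_degen.
End EilenbergMacLane.

(* Main.v *)
Require Import Defs.
From mathcomp Require Import all_boot perm all_algebra.
From mathcomp Require Import zify.

Set Implicit Arguments.
Unset Strict Implicit.
Unset Printing Implicit Defensive.

Import GRing.Theory.
Local Open Scope ring_scope.

(** Both identities hold term by term once the sums are reindexed.

    A face or degeneracy operator is determined by its effect on vertices.  In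
    the term of H indexed by p, q and a shuffle (alpha, beta), with
    m = n - p - q, both components of the new simplex follow the vertices
    0, ..., m - 1 unchanged.  From position m on, a step in alpha advances the
    first component and a step in beta advances the second; the first component
    repeats the vertex m - 1 at position m, while the second jumps over p
    vertices there ([path_fst], [path_snd]).

    First identity.  AW cuts the new simplex at a position l and keeps the
    front part of the X-component.  If l >= m, that front part contains the
    repeated vertex m - 1 and is degenerate ([front_EML_stall]).  If l < m, the
    front part is the front l-face of x, and the back part is the term of H for
    the back faces of y and z, with the same p, q and shuffle but with m - l in
    place of m ([back_EML_fst], [back_EML_snd]).  The Koszul sign (-1)^l accounts
    for the change of m.

    Second identity.  Here the back part of the Z-component is kept.  It is
    degenerate as soon as a step of alpha occurs at or after the cut
    ([back_EML_stall]), which is always the case if the cut is at 0, since alpha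
    is nonempty.  The surviving shuffles, for a cut at l + 1, end in n - l
    steps of beta, and removing these is a bijection onto the shuffles that
    occur in H on simplices of dimension l ([extend], [sum_extend]).  It
    preserves p and m, and it preserves the sign because the permutation is
    extended by fixed points ([odd_sh_perm_extend]).  The back part of z is then
    its ordinary back face ([back_EML_extend]). *)

(** * Linear maps out of chain modules *)

Section Linear.
Variable k : comPzRingType.

Lemma chains_ext (X : sset) (V : lmodType k) (f g : {linear chains k X -> V}) :
  (forall n (x : X n), f (chain k x) = g (chain k x)) -> f =1 g.
Proof.
move=> fg c; rewrite -[c]quot_reprK.
apply: (@freemod_ext k (simplices X) V (f \o quot_pi _) (g \o quot_pi _)).
by case=> n x; apply: fg.
Qed.

Lemma tens_suml (M N : lmodType k) I (r : seq I) (P : pred I) (F : I -> M)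
    (y : N) :
  tens (\sum_(i <- r | P i) F i) y = \sum_(i <- r | P i) tens (F i) y.
Proof.
by apply: (big_morph (fun u => tens u y)) => [u v|]; rewrite (tensDl, tens0l).
Qed.

Lemma tens_sumr (M N : lmodType k) I (r : seq I) (P : pred I) (F : I -> N)
    (x : M) :
  tens x (\sum_(i <- r | P i) F i) = \sum_(i <- r | P i) tens x (F i).
Proof. exact: (big_morph (tens x) (tensDr x) (tens0r _ x)). Qed.

Lemma chain_mapE (X Y : sset) (f : smap X Y) n (x : X n) :
  chain_map k f (chain k x) = chain k (f n x).
Proof. exact: chains_liftE. Qed.

Lemma koszul_tensorE (X Y X' Y' : sset) d
    (f : {linear chains k X -> chains k X'})
    (g : {linear chains k Y -> chains k Y'}) n (x : X n) (v : chains k Y) :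
  koszul_tensor d f g (tens (chain k x) v) =
  (-1) ^+ (d * n) *: tens (f (chain k x)) (g v).
Proof.
rewrite /koszul_tensor tensor_mapE -tensZl -linearZ; congr (tens (f _) _).
exact: chains_liftE.
Qed.
End Linear.

(** * Sums over initial segments *)

Section SumOrd.
Variables (V : zmodType) (G : nat -> V).

Lemma sum_ord_trunc a b : (b <= a)%N -> (forall i, (b <= i < a)%N -> G i = 0) ->
  \sum_(i < a) G i = \sum_(i < b) G i.
Proof.
move=> ba G0; rewrite (big_ord_widen a G ba) [RHS]big_mkcond /=.
by apply: eq_bigr => i _; case: ltnP => // bi; rewrite G0 ?bi /=.
Qed.

Lemma sum_ord_shift d b : (forall i, (i < d)%N -> G i = 0) ->
  \sum_(i < d + b) G i = \sum_(i < b) G (d + i)%N.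
Proof.
move=> G0; rewrite big_split_ord /= big1 ?add0r // => i _; exact: G0.
Qed.
End SumOrd.

(** * Simplicial operators given on vertices *)

Section VertexOperators.
Implicit Types (g : nat -> nat) (X : sset).

(** Every comparison of iterated faces and degeneracies reduces by this lemma
    to an identity between functions on natural numbers. *)
Lemma acts_by_inj X g g' m n (x : X n) (y y' : X m) :
  acts_by g x y -> acts_by g' x y' -> (forall j, (j <= m)%N -> g j = g' j) ->
  y = y'.
Proof.
case=> f fg -> [f' fg' ->] gg'; congr (act _ x); apply: delta_ext => j.
by rewrite fg fg' gg' // -ltnS.
Qed.

(* The running maximum, cut off at n, turns an arbitrary function into a monotone
   map [m] -> [n]. *)
Fact vop_subproof g m n (i j : 'I_m.+1) : (i <= j)%N ->
  ((inord (minn n (\max_(t < m.+1 | (t <= i)%N) g t)) : 'I_n.+1) <=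
   (inord (minn n (\max_(t < m.+1 | (t <= j)%N) g t)) : 'I_n.+1))%N.
Proof.
move=> ij; rewrite !inordK ?ltnS ?geq_minl // leq_min geq_minl /=.
apply: leq_trans (geq_minr _ _) _; apply/bigmax_leqP => t ti.
by apply: leq_bigmax_cond; apply: leq_trans ij.
Qed.

(** Total in [g], [m] and [n], so that simplices can be indexed by natural
    numbers without casts or side conditions; the operator is the intended one
    when [g] is monotone with values at most [n] on the vertices up to [m]. *)
Definition vop g m n : delta m n := mk_delta (@vop_subproof g m n).

Definition vact X g m n (x : X n) : X m := act (vop g m n) x.

Lemma vopE g m n : {in [pred i | (i <= m)%N] &, {homo g : i j / (i <= j)%N}} ->
  (g m <= n)%N -> forall j, vop g m n j = g j :> nat.
Proof.
move=> mono gm j; rewrite ffunE inordK ?ltnS ?geq_minl //.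
have -> : \max_(t < m.+1 | (t <= j)%N) g t = g j.
  apply/eqP; rewrite eqn_leq; apply/andP; split.
    by apply/bigmax_leqP => t tj; apply: mono => //; apply: leq_ord.
  exact: (@leq_bigmax_cond _ _ (fun t => g (nat_of_ord t))).
by apply/minn_idPr; apply: leq_trans gm; apply: mono; rewrite ?inE ?leq_ord.
Qed.

Lemma acts_by_vact X g m n (x : X n) :
  {in [pred i | (i <= m)%N] &, {homo g : i j / (i <= j)%N}} -> (g m <= n)%N ->
  acts_by g x (vact g m x).
Proof. by move=> mono gm; exists (vop g m n) => //; apply: vopE. Qed.

(** A simplex obtained through the vertex map [g] by whatever composite of faces,
    degeneracies and casts has the cast-free normal form [vact g m x]. *)
Lemma acts_by_vactE X g m n (x : X n) (y : X m) : acts_by g x y -> y = vact g m x.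
Proof.
move=> gxy; apply: (acts_by_inj gxy (acts_by_vact _ _ _)) => //.
- case: gxy => f fg _ i j; rewrite !inE => im jm ij.
  by have := @delta_mono _ _ f (inord i) (inord j); rewrite !fg !inordK //; apply.
- by case: gxy => f fg _; rewrite -[m in g m]/(nat_of_ord (@ord_max m)) -fg leq_ord.
Qed.

Lemma acts_by_front X l n (x : X n) : (l <= n)%N -> acts_by id x (vact id l x).
Proof. by move=> ln; apply: acts_by_vact. Qed.

Lemma acts_by_back X l n (x : X n) :
  (l <= n)%N -> acts_by (addn l) x (vact (addn l) (n - l) x).
Proof.
move=> ln; apply: acts_by_vact; last by rewrite subnKC.
by move=> i j _ _ ij; rewrite leq_add2l.
Qed.

Lemma AWE (k : comPzRingType) (X Y : sset) n (x : X n) (y : Y n) :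
  AW k X Y (chain k ((x, y) : sprod X Y n)) =
  \sum_(l < n.+1) tens (chain k (vact id l x)) (chain k (vact (addn l) (n - l) y)).
Proof.
rewrite /AW chains_liftE; apply: eq_bigr => l _ /=.
congr tens; congr chain; apply: acts_by_vactE.
  apply: acts_by_eq (acts_by_comp (acts_by_cast _ _) (acts_by_faces _ (leqnn _))).
  by move=> j jl /=; rewrite ltnS jl.
apply: acts_by_eq (acts_by_comp (acts_by_cast _ _) (acts_by_faces _ (leq0n _))).
by move=> j jl /=; rewrite addnC.
Qed.
End VertexOperators.

(** * The vertex maps of the Eilenberg--Mac Lane homotopy *)

Section Below.
Variable N : nat.
Implicit Type A : {set 'I_N}.

Definition below m A j := #|[set i in A | (i + m < j)%N]|.

Lemma below_shift l m A j : below (m + l) A (j + l) = below m A j.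
Proof. by apply: eq_card => i; rewrite !inE addnA ltn_add2r. Qed.

Lemma below_le m A j : (below m A j <= j - m)%N.
Proof.
have [jN|Nj] := leqP (j - m) N; last first.
  by rewrite (leq_trans (max_card _)) ?card_ord // ltnW.
have -> : (j - m = #|[set i : 'I_N | (i < j - m)%N]|)%N.
  by rewrite -sum1dep_card (big_ord_narrow jN) sum1_card card_ord.
by apply/subset_leq_card/subsetP => i; rewrite !inE => /andP[_ ?]; lia.
Qed.

Lemma below0 m A j : (j <= m)%N -> below m A j = 0%N.
Proof. by move=> jm; have := below_le m A j; lia. Qed.

Lemma below_step m A (t : 'I_N) :
  t \in A -> below m A (t + m).+1 = (below m A (t + m)).+1.
Proof.
move=> tA; rewrite /below (cardsD1 t) !inE tA ltnS leqnn add1n; congr _.+1.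
apply: eq_card => i; rewrite !inE -val_eqE /=.
by case: (i \in A) => /=; lia.
Qed.

Lemma below_all m A j : (forall t, t \in A -> (t + m < j)%N) -> below m A j = #|A|.
Proof.
move=> Aj; apply: eq_card => i; rewrite !inE.
by case: (boolP (i \in A)) => // /Aj ->.
Qed.
End Below.

(** The vertex maps of the two components of a term of the homotopy, [A] being
    alpha and [m] the offset n - p - q.  Both depend on the shuffle only through
    the number of steps of alpha before position [j], since the other steps from
    [m] on belong to beta. *)
Definition path_fst N m (A : {set 'I_N}) j := (minn j m.-1 + below m A j)%N.
Definition path_snd N m p (A : {set 'I_N}) j :=
  (j + (if m <= j then p else 0) - below m A j)%N.

Section PathShift.
Variables (N : nat) (A : {set 'I_N}).

Lemma path_fst_small m j : (j < m)%N -> path_fst m A j = j.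
Proof. by move=> jm; rewrite /path_fst below0; lia. Qed.

(** The degeneracy s_(m-1) in the first component. *)
Lemma path_fst_stall m : (0 < m)%N -> path_fst m A m.-1 = path_fst m A m.
Proof. by move=> m0; rewrite /path_fst !below0; lia. Qed.

Lemma path_fst_shift m l j : (l < m)%N ->
  path_fst m A (l + j) = (l + path_fst (m - l) A j)%N.
Proof.
move=> lm; rewrite /path_fst -[m in below m](subnK (ltnW lm)) [(l + j)%N]addnC.
by rewrite below_shift; lia.
Qed.

Lemma path_snd_shift m p l j : (l < m)%N ->
  path_snd m p A (l + j) = (l + path_snd (m - l) p A j)%N.
Proof.
move=> lm; rewrite /path_snd -[m in below m](subnK (ltnW lm)) [(l + j)%N]addnC.
rewrite below_shift; have := below_le (m - l) A j.
by case: ifP; case: ifP; lia.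
Qed.

(** The degeneracies s_(alpha+m) in the second component. *)
Lemma path_snd_stall m p (t : 'I_N) : t \in A ->
  path_snd m p A (t + m) = path_snd m p A (t + m).+1.
Proof.
move=> tA; rewrite /path_snd below_step //; have := below_le m A (t + m).
by case: ifP; case: ifP; lia.
Qed.

(** The jump over p vertices and the p + 1 repetitions leave a net delay of one
    once alpha is exhausted. *)
Lemma path_snd_late m p j : #|A| = p.+1 ->
  (forall t, t \in A -> t + m < j)%N -> path_snd m p A j = j.-1.
Proof.
move=> cA Aj; have := below_le m A j; rewrite /path_snd below_all // cA.
by case: ifP; lia.
Qed.
End PathShift.

(** * The maps on generators *)

Section EMLexpansion.
Variables X Y : sset.

Section Ops.
Variables (n : nat) (p q : 'I_n) (a : shuffle p.+1 q).
Hypothesis pq : (p + q < n)%N.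
Let m := (n - p - q)%N.

Lemma acts_by_EML_fst (x : X n) :
  acts_by (path_fst m (sh_alpha a)) x (EML_fst a x).
Proof.
apply: acts_by_eq (EML_fst_acts a pq x) => j jn /=.
rewrite /path_fst; have [mj|jm] := leqP m j.
  (* The steps before j of beta are those from m on that are not in alpha. *)
  have := @count_shift_revC _ m (sh_alpha a) j.
  rewrite !count_shift_rev -/m -/(below m _ j) -/(sh_beta a).
  rewrite -/(below m (sh_beta a) j) => E; have {}E := E ltac:(lia).
  by rewrite /unbump; lia.
rewrite !count_shift_rev -/m -/(below m _ j) -/(below m _ j) !below0 1?ltnW //.
by rewrite /unbump; lia.
Qed.

Lemma acts_by_EML_snd (y : Y n) :
  acts_by (path_snd m p (sh_alpha a)) y (EML_snd a y).
Proof.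
apply: acts_by_eq (EML_snd_acts a pq y) => j jn /=.
rewrite /path_snd count_shift_rev -/m -/(below m _ j).
by have := below_le m (sh_alpha a) j; case: ifP; case: ifP; lia.
Qed.
End Ops.

Lemma acts_by_path_fst n p q (a : shuffle p.+1 q) (x : X n) : (p + q < n)%N ->
  let g := path_fst (n - p - q) (sh_alpha a) in acts_by g x (vact g n.+1 x).
Proof.
move=> pq g; have [pn qn] : (p < n /\ q < n)%N by lia.
have gx := @acts_by_EML_fst n (Ordinal pn) (Ordinal qn) a pq x.
by rewrite -(acts_by_vactE gx).
Qed.

Lemma acts_by_path_snd n p q (a : shuffle p.+1 q) (y : Y n) : (p + q < n)%N ->
  let g := path_snd (n - p - q) p (sh_alpha a) in acts_by g y (vact g n.+1 y).
Proof.
move=> pq g; have [pn qn] : (p < n /\ q < n)%N by lia.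
have gy := @acts_by_EML_snd n (Ordinal pn) (Ordinal qn) a pq y.
by rewrite -(acts_by_vactE gy).
Qed.

(** With q < n - p as the bound of the inner sum, the terms p >= n are empty, so
    the bound of the outer sum can be any M >= n; this lets sums for simplices of
    different dimensions be compared termwise in p. *)
Lemma EMLE (k : comPzRingType) M n (x : X n) (y : Y n) : (n <= M)%N ->
  EML k X Y (chain k ((x, y) : sprod X Y n)) =
  \sum_(p < M) \sum_(q < n - p) \sum_(a : shuffle p.+1 q)
    (-1) ^+ (n - p - q + 1 + sh_perm a) *:
    chain k ((vact (path_fst (n - p - q) (sh_alpha a)) n.+1 x,
              vact (path_snd (n - p - q) p (sh_alpha a)) n.+1 y)
             : sprod X Y n.+1).
Proof.
move=> nM; rewrite /EML chains_liftE /EML_simplex.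
pose F p q := \sum_(a : shuffle p.+1 q)
    (-1) ^+ (n - p - q + 1 + sh_perm a) *:
    chain k ((vact (path_fst (n - p - q) (sh_alpha a)) n.+1 x,
              vact (path_snd (n - p - q) p (sh_alpha a)) n.+1 y)
             : sprod X Y n.+1).
rewrite (@sum_ord_trunc _ (fun p => \sum_(q < n - p) F p q) M n nM); last first.
  move=> p /andP[np _]; apply: big1 => q _.
  by exfalso; case: q => q /=; lia.
apply: eq_bigr => p _; rewrite (big_ord_widen n (F p)) ?leq_subr //.
apply: eq_big => [q|q pq]; first by lia.
apply: eq_bigr => a _; congr (_ *: chain k _); congr pair; apply: acts_by_vactE.
  exact: acts_by_EML_fst.
exact: acts_by_EML_snd.
Qed.
End EMLexpansion.

(** * Shuffles that end in steps of beta *)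

(** Each added fixed point is the case of [odd_lift_perm] in which the largest
    element is sent to the largest element, where the parity does not change. *)
Lemma odd_perm_extend N M (s : 'S_N) (s' : 'S_M) : (N <= M)%N ->
  (forall (i : 'I_N) (j : 'I_M), i = j :> nat -> s' j = s i :> nat) ->
  (forall j : 'I_M, (N <= j)%N -> s' j = j) ->
  odd_perm s' = odd_perm s.
Proof.
move=> /subnK; move: (M - N)%N => d; elim: d => [|d IH] in N s *.
  rewrite add0n => NM; case: M / NM s' => s' ss' _; congr odd_perm.
  by apply/permP => i; apply/val_inj/ss'.
rewrite addSnnS => NM ss' s'id.
have -> : odd_perm s = odd_perm (lift_perm ord_max ord_max s).
  by rewrite odd_lift_perm addbb.
apply: IH => // [i j ij|j Nj]; last by apply: s'id; apply: ltnW.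
case: (unliftP ord_max i) ij => [i'|] -> ij.
  by rewrite lift_perm_lift !lift_max; apply: ss'; rewrite -ij lift_max.
by rewrite lift_perm_id s'id -ij.
Qed.

Section Extend.
Variables p q d : nat.

Definition widen_beta : 'I_(p.+1 + q) -> 'I_(p.+1 + (d + q)) :=
  widen_ord (leq_add (leqnn p.+1) (leq_addl d q)).

Lemma widen_beta_inj : injective widen_beta.
Proof. by move=> i j /(congr1 val) /= /val_inj. Qed.

Fact extend_subproof (a : shuffle p.+1 q) : #|widen_beta @: sh_alpha a| == p.+1.
Proof. by rewrite (card_imset _ widen_beta_inj) card_alpha. Qed.

(** Keeping the positions of alpha appends [d] steps to beta, its complement. *)
Definition extend (a : shuffle p.+1 q) : shuffle p.+1 (d + q) :=
  exist _ (widen_beta @: sh_alpha a) (extend_subproof a).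

Lemma extend_inj : injective extend.
Proof. by move=> a b /(congr1 val) /= /(imset_inj widen_beta_inj)/val_inj. Qed.

Lemma extend_onto (b : shuffle p.+1 (d + q)) :
  (forall t, t \in sh_alpha b -> t < p.+1 + q)%N -> exists a, b = extend a.
Proof.
move=> bq; have bE : widen_beta @: (widen_beta @^-1: sh_alpha b) = sh_alpha b.
  apply/setP => t; apply/imsetP/idP => [[i]|tb]; first by rewrite inE => ? ->.
  have tE : t = widen_beta (Ordinal (bq _ tb)) by apply: val_inj.
  by exists (Ordinal (bq _ tb)); rewrite ?inE -?tE.
have ca : #|widen_beta @^-1: sh_alpha b| == p.+1.
  by rewrite -(card_imset _ widen_beta_inj) bE card_alpha.
exists (exist (fun A : {set _} => #|A| == p.+1) _ ca).
by apply: val_inj; rewrite /= -[LHS]bE.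
Qed.

Lemma below_extend m (a : shuffle p.+1 q) j :
  below m (sh_alpha (extend a)) j = below m (sh_alpha a) j.
Proof.
rewrite /below -(card_imset _ widen_beta_inj); apply: eq_card => t.
rewrite !inE; apply/andP/imsetP => [[/imsetP[i ia ->] ij]|[i]].
  by exists i; rewrite // inE ia.
by rewrite inE => /andP[ia ij] ->; rewrite imset_f.
Qed.

Lemma sorted_val_enum N (A : {set 'I_N}) : sorted ltn [seq val i | i <- enum A].
Proof.
rewrite sorted_map /enum_mem -enumT; apply: sorted_filter => [i j l /=|].
  exact: ltn_trans.
by rewrite -sorted_map val_enum_ord iota_ltn_sorted.
Qed.

Lemma val_enum_alpha (a : shuffle p.+1 q) :
  [seq val i | i <- enum (sh_alpha (extend a))] = [seq val i | i <- enum (sh_alpha a)].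
Proof.
apply: (irr_sorted_eq ltn_trans ltnn); rewrite ?sorted_val_enum // => t.
apply/mapP/mapP => -[i]; rewrite mem_enum.
  by case/imsetP => i' i'a -> ->; exists i'; rewrite ?mem_enum.
move=> ia ->; exists (widen_beta i) => //.
by rewrite mem_enum imset_f.
Qed.

(** The appended positions are larger than all others, so they come last in the
    increasing enumeration of beta; hence they are fixed by the permutation. *)
Lemma val_enum_beta (a : shuffle p.+1 q) :
  [seq val i | i <- enum (sh_beta (extend a))] =
  [seq val i | i <- enum (sh_beta a)] ++ iota (p.+1 + q) d.
Proof.
apply: (irr_sorted_eq ltn_trans ltnn); rewrite ?sorted_val_enum //.
  rewrite (sorted_pairwise ltn_trans) pairwise_cat -!(sorted_pairwise ltn_trans).
  rewrite sorted_val_enum iota_ltn_sorted !andbT; apply/allrelP => i j.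
  case/mapP => u _ ->; rewrite mem_iota => /andP[? _].
  by apply: leq_trans (ltn_ord u) _.
move=> t; rewrite mem_cat mem_iota; apply/mapP/orP => [[i]|[/mapP[i]|tq]].
- rewrite mem_enum inE => ia ->; have [iq|qi] := ltnP i (p.+1 + q).
    left; apply/mapP; exists (Ordinal iq) => //; rewrite mem_enum inE.
    apply: contra ia => ia; apply/imsetP; exists (Ordinal iq) => //.
    exact: val_inj.
  by right; have /= := ltn_ord i; lia.
- rewrite mem_enum inE => ia ->; exists (widen_beta i) => //.
  by rewrite mem_enum inE (mem_imset _ _ widen_beta_inj).
- have tN : (t < p.+1 + (d + q))%N by lia.
  exists (Ordinal tN) => //; rewrite mem_enum inE.
  by apply/imsetP => -[i _ /(congr1 val) /= tE]; have := ltn_ord i; lia.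
Qed.

Lemma val_sh_perm r s (a : shuffle r s) i :
  sh_perm a i = nth 0%N ([seq val i | i <- enum (sh_alpha a)] ++
                         [seq val i | i <- enum (sh_beta a)]) i :> nat.
Proof.
rewrite permE -map_cat (nth_map i) // size_cat -!cardE card_alpha card_beta.
exact: ltn_ord.
Qed.

Lemma odd_sh_perm_extend (a : shuffle p.+1 q) :
  odd_perm (sh_perm (extend a)) = odd_perm (sh_perm a).
Proof.
have sz : size ([seq val i | i <- enum (sh_alpha a)] ++
                [seq val i | i <- enum (sh_beta a)]) = (p.+1 + q)%N.
  by rewrite size_cat !size_map -!cardE card_alpha card_beta.
apply: odd_perm_extend => [|i j ij|j pj]; first by lia.
  rewrite !val_sh_perm val_enum_alpha val_enum_beta catA nth_cat sz -ij.
  by rewrite ltn_ord.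
apply: val_inj; rewrite /= val_sh_perm val_enum_alpha val_enum_beta catA nth_cat sz.
rewrite ltnNge pj /= nth_iota; last by have := ltn_ord j; lia.
by lia.
Qed.

(** A shuffle all of whose steps of alpha are among the first p + 1 + q positions
    arises from [extend], so F vanishes on all the others. *)
Lemma sum_extend (V : zmodType) (F : shuffle p.+1 (d + q) -> V) :
  (forall b t, t \in sh_alpha b -> (p.+1 + q <= t)%N -> F b = 0) ->
  \sum_b F b = \sum_a F (extend a).
Proof.
move=> F0; rewrite (bigID (mem [set extend a | a in [set: shuffle p.+1 q]])) /=.
rewrite big_imset => [|a b _ _ /extend_inj //] /=.
rewrite [X in _ + X]big1 ?addr0; first by apply: eq_bigl => a; rewrite inE.
move=> b; have [/existsP[t /andP[tb qt]] _|/existsPn bN] :=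
  boolP [exists t, (t \in sh_alpha b) && (p.+1 + q <= t)%N]; first exact: F0 tb qt.
have [|a ->] := @extend_onto b; last by rewrite imset_f.
by move=> t tb; have := bN t; rewrite tb /= -ltnNge.
Qed.
End Extend.

(** The p + 1 steps of alpha do not fit into the r <= p positions before r. *)
Lemma exists_late p q (a : shuffle p.+1 q) r : (r < p.+1)%N ->
  exists2 t, t \in sh_alpha a & (r <= t)%N.
Proof.
move=> rp; apply/exists_inP; apply: contraLR rp => /exists_inPn aN.
rewrite -leqNgt -(card_alpha a).
have -> : #|sh_alpha a| = below 0 (sh_alpha a) r.
  by rewrite below_all // => t /aN; rewrite addn0 -ltnNge.
by rewrite (leq_trans (below_le _ _ _)) // subn0.
Qed.

(** * Faces of the terms of the homotopy *)

(** The linear map is a variable in the next two lemmas because rewriting with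
    the linearity of a concrete map out of a quotient would unfold that map. *)
Lemma linear_AWE (k : comPzRingType) (A B : sset) (V : lmodType k)
    (g : {linear tensor (chains k A) (chains k B) -> V}) n (u : A n) (v : B n) :
  g (AW k A B (chain k ((u, v) : sprod A B n))) =
  \sum_(l < n.+1)
    g (tens (chain k (vact id l u)) (chain k (vact (addn l) (n - l) v))).
Proof. by rewrite AWE linear_sum. Qed.

Lemma linear_EMLE (k : comPzRingType) (P Q : sset) (V : lmodType k)
    (g : {linear chains k (sprod P Q) -> V}) n (x : P n) (y : Q n) :
  g (EML k P Q (chain k ((x, y) : sprod P Q n))) =
  \sum_(p < n) \sum_(q < n - p) \sum_(a : shuffle p.+1 q)
    (-1) ^+ (n - p - q + 1 + sh_perm a) *:
    g (chain k ((vact (path_fst (n - p - q) (sh_alpha a)) n.+1 x,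
                 vact (path_snd (n - p - q) p (sh_alpha a)) n.+1 y)
                : sprod P Q n.+1)).
Proof.
rewrite (EMLE k x y (leqnn n)) linear_sum; apply: eq_bigr => p _.
rewrite linear_sum; apply: eq_bigr => q _; rewrite linear_sum.
by apply: eq_bigr => a _; rewrite linearZ.
Qed.

Lemma AW_EMLE (k : comPzRingType) (P Q A B : sset)
    (f : smap (sprod P Q) (sprod A B)) n (x : P n) (y : Q n) :
  AW k A B (chain_map k f (EML k P Q (chain k ((x, y) : sprod P Q n)))) =
  \sum_(l < n.+2) \sum_(p < n) \sum_(q < n - p) \sum_(a : shuffle p.+1 q)
    (-1) ^+ (n - p - q + 1 + sh_perm a) *:
    let w := f n.+1 (vact (path_fst (n - p - q) (sh_alpha a)) n.+1 x,
                     vact (path_snd (n - p - q) p (sh_alpha a)) n.+1 y) in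
    tens (chain k (vact id l w.1)) (chain k (vact (addn l) (n.+1 - l) w.2)).
Proof.
pose g : {linear chains k (sprod P Q) -> _} := AW k A B \o chain_map k f.
transitivity (g (EML k P Q (chain k ((x, y) : sprod P Q n)))) => //.
rewrite linear_EMLE [RHS]exchange_big; apply: eq_bigr => p _.
rewrite [RHS]exchange_big; apply: eq_bigr => q _.
rewrite [RHS]exchange_big; apply: eq_bigr => a _.
set w := (_, _); rewrite -scaler_sumr; congr (_ *: _).
transitivity (AW k A B (chain_map k f (chain k (w : sprod P Q n.+1)))) => //.
by rewrite chain_mapE; case: (f _ _) => u v; rewrite AWE.
Qed.

Section PathFaces.
Variables (k : comPzRingType) (X : sset).

(** A front face of dimension at least m contains both m - 1 and m, at which the
    first component has the same vertex. *)
Lemma front_EML_stall n p q (a : shuffle p.+1 q) (x : X n) l :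
  (p + q < n)%N -> (n - p - q <= l <= n.+1)%N ->
  chain k (vact id l (vact (path_fst (n - p - q) (sh_alpha a)) n.+1 x)) = 0.
Proof.
move=> pq /andP[ml ln]; have mE : ((n - p - q).-1.+1 = n - p - q)%N by lia.
apply: (@chain_acts_by0 _ _ _ _ _ _ _ (n - p - q).-1); first by lia.
  exact: acts_by_comp (acts_by_path_fst a x pq) (acts_by_front _ ln).
by rewrite /= mE path_fst_stall // -mE.
Qed.

(** Before position m the first component runs through its vertices one by one. *)
Lemma front_EML_fst n p q (a : shuffle p.+1 q) (x : X n) l :
  (l < n - p - q)%N ->
  vact id l (vact (path_fst (n - p - q) (sh_alpha a)) n.+1 x) = vact id l x.
Proof.
move=> lm; have pq : (p + q < n)%N by lia.
apply: (acts_by_inj (acts_by_comp (acts_by_path_fst a x pq) (acts_by_front _ _)));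
  [by lia|by apply: acts_by_front; lia|move=> j jl].
by rewrite /= path_fst_small //; lia.
Qed.

(** Cutting before position m only shortens the initial common run of both
    components, so a term of the homotopy is sent to the corresponding term
    for the back faces. *)
Lemma back_EML_fst n p q (a : shuffle p.+1 q) (x : X n) l :
  (l < n - p - q)%N ->
  vact (addn l) (n - l).+1 (vact (path_fst (n - p - q) (sh_alpha a)) n.+1 x) =
  vact (path_fst (n - l - p - q) (sh_alpha a)) (n - l).+1 (vact (addn l) (n - l) x).
Proof.
move=> lm; have pq : (p + q < n)%N by lia.
have ln : (l <= n.+1)%N by lia.
have Hl := acts_by_comp (acts_by_path_fst a x pq) (acts_by_back _ ln).
have pq' : (p + q < n - l)%N by lia.
have ln' : (l <= n)%N by lia.
have Hr := acts_by_comp (acts_by_back x ln') (acts_by_path_fst a _ pq').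
move: Hl Hr; rewrite subSn // => Hl Hr; apply: (acts_by_inj Hl Hr) => j _.
have mE : (n - l - p - q = n - p - q - l)%N by lia.
by rewrite /= path_fst_shift // mE.
Qed.

Lemma back_EML_snd n p q (a : shuffle p.+1 q) (x : X n) l :
  (l < n - p - q)%N ->
  vact (addn l) (n - l).+1 (vact (path_snd (n - p - q) p (sh_alpha a)) n.+1 x) =
  vact (path_snd (n - l - p - q) p (sh_alpha a)) (n - l).+1 (vact (addn l) (n - l) x).
Proof.
move=> lm; have pq : (p + q < n)%N by lia.
have ln : (l <= n.+1)%N by lia.
have Hl := acts_by_comp (acts_by_path_snd a x pq) (acts_by_back _ ln).
have pq' : (p + q < n - l)%N by lia.
have ln' : (l <= n)%N by lia.
have Hr := acts_by_comp (acts_by_back x ln') (acts_by_path_snd a _ pq').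
move: Hl Hr; rewrite subSn // => Hl Hr; apply: (acts_by_inj Hl Hr) => j _.
have mE : (n - l - p - q = n - p - q - l)%N by lia.
by rewrite /= path_snd_shift // mE.
Qed.

(** A step of alpha at or after the cut is a repeated vertex of the back face. *)
Lemma back_EML_stall n p q (a : shuffle p.+1 q) t (x : X n) l :
  (p + q < n)%N -> (l <= n.+1)%N -> t \in sh_alpha a -> (l <= t + (n - p - q))%N ->
  chain k (vact (addn l) (n.+1 - l)
             (vact (path_snd (n - p - q) p (sh_alpha a)) n.+1 x)) = 0.
Proof.
move=> pq ln ta lt; have tN := ltn_ord t.
apply: (@chain_acts_by0 _ _ _ _ _ _ _ (t + (n - p - q) - l)); first by lia.
  exact: acts_by_comp (acts_by_path_snd a x pq) (acts_by_back _ ln).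
by rewrite /= addnS subnKC // path_snd_stall //; lia.
Qed.

Section ExtendFaces.
Variables (n l p q : nat) (a : shuffle p.+1 q) (x : X n).
Hypotheses (ln : (l <= n)%N) (pq : (p + q < l)%N).
(* The term of the homotopy in dimension n that restricts to the one of [a] in
   dimension l; the offset m is the same for both, the added n - l elements of
   beta being compensated by the change of dimension. *)
Let b := extend (n - l) a.
Let m := (n - p - (n - l + q))%N.
Let mE : m = (l - p - q)%N. Proof. by rewrite /m; lia. Qed.
Let pq' : (p + (n - l + q) < n)%N. Proof. by lia. Qed.

Lemma front_EML_extend_fst :
  vact id l.+1 (vact (path_fst m (sh_alpha b)) n.+1 x) =
  vact (path_fst (l - p - q) (sh_alpha a)) l.+1 (vact id l x).
Proof.
apply: (acts_by_inj
  (acts_by_comp (acts_by_path_fst b x pq') (acts_by_front _ _))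
  (acts_by_comp (acts_by_front x ln) (acts_by_path_fst a _ pq))) => // j _.
by rewrite /= /path_fst below_extend -/m mE.
Qed.

Lemma front_EML_extend_snd :
  vact id l.+1 (vact (path_snd m p (sh_alpha b)) n.+1 x) =
  vact (path_snd (l - p - q) p (sh_alpha a)) l.+1 (vact id l x).
Proof.
apply: (acts_by_inj
  (acts_by_comp (acts_by_path_snd b x pq') (acts_by_front _ _))
  (acts_by_comp (acts_by_front x ln) (acts_by_path_snd a _ pq))) => // j _.
by rewrite /= /path_snd below_extend -/m mE.
Qed.

(** All steps of alpha lie before the cut l + 1, so from there on the second
    component runs one vertex behind its position: vertices l, ..., n of x. *)
Lemma back_EML_extend :
  vact (addn l.+1) (n - l) (vact (path_snd m p (sh_alpha b)) n.+1 x) =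
  vact (addn l) (n - l) x.
Proof.
apply: (acts_by_inj
  (acts_by_comp (acts_by_path_snd b x pq') (@acts_by_back _ l.+1 n.+1 _ ln))
  (acts_by_back x ln)) => j _.
rewrite /= -/m mE path_snd_late ?card_alpha // => t /imsetP[i _ ->] /=.
by have := ltn_ord i; lia.
Qed.
End ExtendFaces.
End PathFaces.

(** * The two identities *)

Section FirstIdentity.
Variables (k : comPzRingType) (X Y Z : sset).

Lemma AW_EML_last :
  AW k X (sprod Y Z) \o chain_map k (sprod_assoc X Y Z) \o EML k (sprod X Y) Z
  =1 koszul_tensor 1 idfun (EML k Y Z)
     \o AW k X (sprod Y Z) \o chain_map k (sprod_assoc X Y Z).
Proof.
apply: chains_ext => n [[x y] z].
transitivity (AW k X (sprod Y Z) (chain_map k (sprod_assoc X Y Z)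
  (EML k (sprod X Y) Z (chain k (((x, y), z) : sprod (sprod X Y) Z n))))) => //.
transitivity (koszul_tensor 1 idfun (EML k Y Z) (AW k X (sprod Y Z)
  (chain_map k (sprod_assoc X Y Z)
    (chain k (((x, y), z) : sprod (sprod X Y) Z n))))) => //.
rewrite AW_EMLE chain_mapE linear_AWE big_ord_recr [LHS]/=.
(* At l = n + 1 there is no term on the right: the cut is after all offsets m. *)
rewrite [X in _ + X]big1 ?addr0 => [|p _]; last first.
  apply: big1 => q _; apply: big1 => a _ /=.
  by rewrite (front_EML_stall _ a) ?tens0l ?scaler0 //; case: p q a => p /= ? [q /= ?]; lia.
apply: eq_bigr => l _; rewrite koszul_tensorE.
rewrite (@EMLE Y Z k n (n - l) (vact (addn l) (n - l) y) (vact (addn l) (n - l) z)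
           (leq_subr _ _)).
rewrite tens_sumr scaler_sumr; apply: eq_bigr => p _.
rewrite tens_sumr scaler_sumr.
pose G (q : nat) := \sum_(a : shuffle p.+1 q)
    (-1) ^+ (n - p - q + 1 + sh_perm a) *:
    tens (chain k (vact id l (vact (path_fst (n - p - q) (sh_alpha a)) n.+1 x)))
      (chain k ((vact (addn l) (n.+1 - l)
                   (vact (path_fst (n - p - q) (sh_alpha a)) n.+1 y),
                 vact (addn l) (n.+1 - l)
                   (vact (path_snd (n - p - q) p (sh_alpha a)) n.+1 z))
                : sprod Y Z (n.+1 - l)%N)).
(* The terms with m <= l are the ones without a counterpart on the right. *)
rewrite (@sum_ord_trunc _ G _ (n - l - p)); first last.
- move=> q ql; apply: big1 => a _.
  by rewrite (front_EML_stall _ a) ?tens0l ?scaler0 //; have := ltn_ord l; lia.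
- lia.
apply: eq_bigr => q _; rewrite tens_sumr scaler_sumr; apply: eq_bigr => a _.
have lm : (l < n - p - q)%N by have := ltn_ord q; lia.
rewrite front_EML_fst // subSn; last by lia.
rewrite back_EML_fst // back_EML_snd // tensZr scalerA mul1n -exprD.
congr (_ *: _); rewrite -signr_odd -[RHS]signr_odd; congr (_ ^+ nat_of_bool _); lia.
Qed.
End FirstIdentity.

Section SecondIdentity.
Variables (k : comPzRingType) (X Y Z : sset).

Lemma AW_EML_first :
  AW k (sprod X Y) Z \o chain_map k (sprod_assoc_inv X Y Z) \o EML k X (sprod Y Z)
  =1 koszul_tensor 0 (EML k X Y) idfun
     \o AW k (sprod X Y) Z \o chain_map k (sprod_assoc_inv X Y Z).
Proof.
apply: chains_ext => n [x [y z]].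
transitivity (AW k (sprod X Y) Z (chain_map k (sprod_assoc_inv X Y Z)
  (EML k X (sprod Y Z) (chain k ((x, (y, z)) : sprod X (sprod Y Z) n))))) => //.
transitivity (koszul_tensor 0 (EML k X Y) idfun (AW k (sprod X Y) Z
  (chain_map k (sprod_assoc_inv X Y Z)
    (chain k ((x, (y, z)) : sprod X (sprod Y Z) n))))) => //.
rewrite AW_EMLE chain_mapE linear_AWE big_ord_recl [LHS]/=.
(* The cut at 0 leaves all of alpha in the back part.  A cut at l + 1 on the left
   is matched with the cut at l on the right, H raising the degree by one. *)
rewrite [X in X + _]big1 ?add0r => [|p _]; last first.
  apply: big1 => q _; apply: big1 => a _ /=.
  have [t ta _] := exists_late a (ltn0Sn p).
  by rewrite (back_EML_stall _ _ _ _ ta) ?tens0r ?scaler0 //;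
     have := ltn_ord q; lia.
apply: eq_bigr => l _; rewrite koszul_tensorE mul0n scale1r.
have ln : (l <= n)%N by have := ltn_ord l.
rewrite (@EMLE X Y k n l (vact id l x) (vact id l y) ln) tens_suml.
apply: eq_bigr => p _; rewrite tens_suml.
pose T q (a : shuffle p.+1 q) :=
  (-1) ^+ (n - p - q + 1 + sh_perm a) *:
  tens (chain k ((vact id l.+1 (vact (path_fst (n - p - q) (sh_alpha a)) n.+1 x),
                  vact id l.+1 (vact (path_snd (n - p - q) p (sh_alpha a)) n.+1 y))
                 : sprod X Y l.+1))
    (chain k (vact (addn l.+1) (n - l)
                (vact (path_snd (n - p - q) p (sh_alpha a)) n.+1 z))).
have T0 q (a : shuffle p.+1 q) t : (p + q < n)%N -> t \in sh_alpha a ->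
    (l < t + (n - p - q))%N -> T q a = 0.
  move=> pq ta lt; rewrite /T (@back_EML_stall k Z n p q a t z l.+1) //.
  by rewrite tens0r scaler0.
transitivity (\sum_(q < n - p) \sum_(a : shuffle p.+1 q) T q a) => //.
(* If beta has fewer elements than there are steps after the cut at l + 1, one of
   these steps belongs to alpha. *)
have Tlow (q : nat) : (q < n - p)%N -> (q < n - l)%N -> \sum_a T q a = 0.
  move=> qn ql; apply: big1 => a _.
  have [|t ta lt] := @exists_late p q a (l.+1 - (n - p - q)); first by lia.
  by apply: (T0 q a t) => //; lia.
have [pl|lp] := leqP p l; last first.
  by rewrite !big1 => // q _; [have := ltn_ord q|apply: Tlow]; have := ltn_ord q; lia.
have -> : (n - p = (n - l) + (l - p))%N by lia.
rewrite (@sum_ord_shift _ (fun q => \sum_(a : shuffle p.+1 q) T q a)); last first.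
  by move=> q ql; apply: Tlow; lia.
apply: eq_bigr => q _; have pq : (p + q < l)%N by have := ltn_ord q; lia.
rewrite sum_extend => [|b t tb qt]; last by apply: (T0 _ b t); lia.
rewrite tens_suml; apply: eq_bigr => a _; rewrite /T.
rewrite front_EML_extend_fst // front_EML_extend_snd // back_EML_extend //.
rewrite tensZl odd_sh_perm_extend.
by have -> : (n - p - (n - l + q) = l - p - q)%N by lia.
Qed.
End SecondIdentity.

Theorem proposition3p1 (k : comPzRingType) (X Y Z : sset) :
  (AW k X (sprod Y Z) \o chain_map k (sprod_assoc X Y Z) \o EML k (sprod X Y) Z
   =1 koszul_tensor 1 idfun (EML k Y Z)
      \o AW k X (sprod Y Z) \o chain_map k (sprod_assoc X Y Z))
  /\
  (AW k (sprod X Y) Z \o chain_map k (sprod_assoc_inv X Y Z) \o EML k X (sprod Y Z)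
   =1 koszul_tensor 0 (EML k X Y) idfun
      \o AW k (sprod X Y) Z \o chain_map k (sprod_assoc_inv X Y Z)).
Proof. by split; [apply: AW_EML_last | apply: AW_EML_first]. Qed.
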